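(* Let $(X,G,W)$ be a convex $G$-metric space with a convex structure $W$, and let $T:X\to X$ be a mapping with a fixed point $u$ satisfying $$G(Tx,Ty,Tz)\le a\,G(x,y,z)+b\,G(x,Tx,Tx)+c\,G(y,Ty,Ty)+d\,G(z,Tz,Tz)$$ for all $x,y,z\in X$, where $a,b,c,d$ are nonnegative real numbers such that $0\le a+3b<1$. Let $x_0\in X$, let $\{\alpha_n\}_{n\ge 0}\subset[0,1]$ satisfy $\sum_{n=0}^{\infty}\alpha_n=\infty$, and let $\{x_n\}$ be the Mann iterative process defined by $$x_{n+1}=W(x_n,Tx_n;1-\alpha_n,\alpha_n),\qquad n=0,1,2,\dots.$$ Then $\{x_n\}$ converges strongly to a fixed point of $T$.
   Context: A $G$-metric space is a pair $(X,G)$ where $X$ is a nonempty set and $G:X\times X\times X\to[0,\infty)$ satisfies: (i) $G(x,y,z)=0$ if $x=y=z$; (ii) $0<G(x,x,y)$ for all $x,y\in X$ with $x\ne y$; (iii) $G(x,x,y)\le G(x,y,z)$ for all $x,y,z\in X$ with $z\ne y$; (iv) $G$ is symmetric in all three variables; (v) $G(x,y,z)\le G(x,a,a)+G(a,y,z)$ for all $x,y,z,a\in X$. A convex structure on a $G$-metric space $(X,G)$ is a mapping $W:X^2\times I^2\to X$, with $I=[0,1]$, such that $G(W(x,y;\lambda,\beta),u,v)\le\lambda G(x,u,v)+\beta G(y,u,v)$ for all $x,y,u,v\in X$ and all $\lambda,\beta\in I$ with $\lambda+\beta=1$. The triple $(X,G,W)$ is then called a convex $G$-metric space. A sequence $\{x_n\}$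 in $X$ converges (strongly, i.e. $G$-converges) to $x\in X$ if $\lim_{n,m\to\infty}G(x,x_n,x_m)=0$; equivalently, $G(x_n,x,x)\to0$ as $n\to\infty$. *)

(* Defs.v *)
From HB Require Import structures.
From mathcomp Require Import all_boot all_order all_algebra.
From mathcomp Require Import all_classical all_reals all_analysis.

Set Implicit Arguments.
Unset Strict Implicit.
Unset Printing Implicit Defensive.

Import Order.TTheory GRing.Theory Num.Theory.
Import numFieldNormedType.Exports.

Local Open Scope classical_set_scope.
Local Open Scope ring_scope.

(* Convergence of sequences of reals is taken over an arbitrary [realType]. *)
Record is_G_metric (R : realType) (X : Type) (G : X -> X -> X -> R) : Prop := {
  Gmetric_inhabited : inhabited X;
  Gmetric_ge0 : forall x y z, 0 <= G x y z;
  Gmetric_diag : forall x y z, x = y -> y = z -> G x y z = 0;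
  Gmetric_gt0 : forall x y, x <> y -> 0 < G x x y;
  Gmetric_le : forall x y z, z <> y -> G x x y <= G x y z;
  (* these two transpositions generate all permutations of the arguments *)
  Gmetric_sym12 : forall x y z, G x y z = G y x z;
  Gmetric_sym23 : forall x y z, G x y z = G x z y;
  Gmetric_rect : forall x y z a, G x y z <= G x a a + G a y z
}.

(* [{i01 R}] is the unit interval as a subtype of [R]. *)
Definition is_convex_structure (R : realType) (X : Type) (G : X -> X -> X -> R)
    (W : X -> X -> {i01 R} -> {i01 R} -> X) : Prop :=
  forall (x y u v : X) (l b : {i01 R}), l%:num + b%:num = 1 ->
    G (W x y l b) u v <= l%:num * G x u v + b%:num * G y u v.

(* The limit is taken as [n] and [m] tend to infinity independently. *)
Definition G_cvg (R : realType) (X : Type) (G : X -> X -> X -> R)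
    (x : nat -> X) (p : X) : Prop :=
  (fun nm : nat * nat => G p (x nm.1) (x nm.2)) @ (\oo, \oo) --> (0 : R).

(* Main.v *)
Require Import Defs.
From HB Require Import structures.
From mathcomp Require Import all_boot all_order all_algebra.
From mathcomp Require Import all_classical all_reals all_analysis.
From mathcomp Require Import ring lra.

(** The limit is the given fixed point [u].  Put [D n := G (x n) u u].  At
    [y = z = u] the contractive condition involves only [G (x n) u u] and the
    displacement of [x n], since [u] has displacement zero.  The rectangle
    inequality bounds that displacement by distances to [u]; as passing from
    [G u (T x) (T x)] to [G (T x) u u] costs a factor two, this gives
    [(1 - 2 * b) * G (T x) u u <= (a + b) * G x u u]
    ([quasi_contraction_fixpoint]).  The ratio [(a + b) / (1 - 2 * b)] is less
    than one exactly because [a + 3 * b < 1].  Convexity then turns the Mann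
    step into [D n.+1 <= (1 - k * alpha n) * D n] with [k > 0], and the
    divergence of the series of the [alpha n] forces [D n] to tend to zero
    ([cvg0_damped]).  Finally [G u (x n) (x m) <= D n + D m]
    ([Gmetric_le_center]) gives convergence in both indices. *)

Set Implicit Arguments.
Unset Strict Implicit.
Unset Printing Implicit Defensive.

Import Order.TTheory GRing.Theory Num.Theory.
Import numFieldNormedType.Exports.

Local Open Scope classical_set_scope.
Local Open Scope ring_scope.

(** A discrete substitute for the product estimate
    [\prod_n (1 - t n) <= expR (- \sum_n t n)]: the quantity
    [D n * (1 + \sum_(k < n) t k)] is nonincreasing, because
    [(1 - t) * (S + t) <= S] whenever [0 <= t] and [1 <= S]. *)
Lemma damped_bound (R : realDomainType) (D t : nat -> R)
    (D_ge0 : forall n, 0 <= D n) (t_ge0 : forall n, 0 <= t n)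
    (stepD : forall n, D n.+1 <= (1 - t n) * D n) (n : nat) :
  D n * (1 + \sum_(0 <= k < n) t k) <= D 0%N.
Proof.
elim: n => [|n IHn]; first by rewrite big_nil addr0 mulr1.
apply: le_trans IHn; rewrite big_nat_recr //= addrA.
have : 0 <= \sum_(0 <= k < n) t k by apply: sumr_ge0.
move: (\sum_(0 <= k < n) t k) => S S_ge0.
apply: (@le_trans _ _ ((1 - t n) * D n * (1 + S + t n))).
  by rewrite ler_wpM2r // !addr_ge0.
rewrite -subr_ge0.
have -> : D n * (1 + S) - (1 - t n) * D n * (1 + S + t n)
        = D n * (t n * (S + t n)) by ring.
by rewrite !mulr_ge0 // addr_ge0.
Qed.

Lemma cvg0_damped (R : realType) (D t : nat -> R)
    (D_ge0 : forall n, 0 <= D n) (t_ge0 : forall n, 0 <= t n)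
    (stepD : forall n, D n.+1 <= (1 - t n) * D n)
    (t_div : (fun n => \sum_(0 <= k < n) t k) @ \oo --> +oo) :
  D @ \oo --> (0 : R).
Proof.
apply/cvgr0Pnorm_le => e e_gt0.
have /cvgryPge/(_ (D 0%N / e)) := t_div.
apply: filterS => n S_large.
rewrite ger0_norm //.
have S_ge0 : 0 <= \sum_(0 <= k < n) t k by apply: sumr_ge0.
have bound := damped_bound D_ge0 t_ge0 stepD n.
rewrite ler_pdivrMr // in S_large.
have S1_gt0 : 0 < 1 + \sum_(0 <= k < n) t k by rewrite ltr_wpDr.
rewrite -(ler_pM2r S1_gt0); apply: le_trans bound _.
by apply: le_trans S_large _; rewrite mulrC ler_pM2l // lerDr.
Qed.

(** The rectangle inequality with [a := u], after moving [y] to the front. It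
    reduces two-index convergence to [u] to convergence of distances. *)
Lemma Gmetric_le_center (R : realType) (X : Type) (G : X -> X -> X -> R)
    (hG : is_G_metric G) (u y z : X) :
  G u y z <= G y u u + G z u u.
Proof.
rewrite (Gmetric_sym12 hG).
apply: le_trans (Gmetric_rect hG _ _ _ u) _.
by rewrite lerD2l (Gmetric_sym23 hG) (Gmetric_sym12 hG).
Qed.

(** The displacement [G x (T x) (T x)] is at most
    [G x u u + 2 * G (T x) u u]; moving the second summand to the left-hand
    side is what produces the factor [1 - 2 * b]. *)
Lemma quasi_contraction_fixpoint (R : realType) (X : Type)
    (G : X -> X -> X -> R) (hG : is_G_metric G)
    (T : X -> X) (u : X) (hu : T u = u) (a b c d : R) (hb : 0 <= b)
    (hT : forall x y z : X,
       G (T x) (T y) (T z) <=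
         a * G x y z + b * G x (T x) (T x)
         + c * G y (T y) (T y) + d * G z (T z) (T z)) (x : X) :
  (1 - 2 * b) * G (T x) u u <= (a + b) * G x u u.
Proof.
have := hT x u u; rewrite !hu (Gmetric_diag hG (erefl u) (erefl u)) => hTx.
have disp : G x (T x) (T x) <= G x u u + (G (T x) u u + G (T x) u u).
  apply: le_trans (Gmetric_rect hG _ _ _ u) _.
  by rewrite lerD2l; exact: Gmetric_le_center.
have := ler_wpM2l hb disp; lra.
Qed.

Theorem theorem2p1 (R : realType) (X : Type) (G : X -> X -> X -> R)
    (W : X -> X -> {i01 R} -> {i01 R} -> X)
    (hG : is_G_metric G) (hW : is_convex_structure G W)
    (T : X -> X) (u : X) (hu : T u = u)
    (a b c d : R) (ha : 0 <= a) (hb : 0 <= b) (hc : 0 <= c) (hd : 0 <= d)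
    (hab : 0 <= a + 3 * b < 1)
    (hT : forall x y z : X,
       G (T x) (T y) (T z) <=
         a * G x y z + b * G x (T x) (T x)
         + c * G y (T y) (T y) + d * G z (T z) (T z))
    (x0 : X) (alpha : nat -> {i01 R})
    (halpha : (fun n => \sum_(0 <= k < n) (alpha k)%:num) @ \oo --> +oo)
    (x : nat -> X) (hx0 : x 0%N = x0)
    (hx : forall n, x n.+1 =
       W (x n) (T (x n)) (1 - (alpha n)%:num)%:i01 (alpha n)) :
  exists p : X, T p = p /\ G_cvg G x p.
Proof.
have b2_gt0 : 0 < 1 - 2 * b by case/andP: hab => _; lra.
pose k := 1 - (a + b) / (1 - 2 * b).
have k_gt0 : 0 < k.
  by rewrite subr_gt0 ltr_pdivrMr // mul1r; case/andP: hab => _; lra.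
have contr y : G (T y) u u <= (1 - k) * G y u u.
  rewrite subKr mulrAC ler_pdivlMr // mulrC.
  exact: (quasi_contraction_fixpoint hG hu hb hT).
pose D n := G (x n) u u.
have stepD n : D n.+1 <= (1 - k * (alpha n)%:num) * D n.
  rewrite /D hx; apply: le_trans (hW _ _ _ _ _ _ _) _; first exact: subrK.
  have alpha_ge0 : 0 <= (alpha n)%:num by [].
  have := ler_wpM2l alpha_ge0 (contr (x n)) => /=; lra.
have D_cvg0 : D @ \oo --> (0 : R).
  apply: (cvg0_damped (t := fun n => k * (alpha n)%:num)) => // [n|n|].
  - exact: Gmetric_ge0 hG _ _ _.
  - by rewrite mulr_ge0 // ltW.
  - under eq_fun do rewrite -mulr_sumr.
    apply/cvgryPge => A; have /cvgryPge/(_ (A / k)) := halpha.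
    by apply: filterS => n; rewrite ler_pdivrMr // mulrC.
exists u; split=> //.
apply: (@squeeze_cvgr _ _ _ _ (cst 0) (fun nm => D nm.1 + D nm.2)).
- near=> nm; apply/andP; split; first exact: Gmetric_ge0 hG _ _ _.
  exact: Gmetric_le_center.
- exact: cvg_cst.
- rewrite -[0 in X in _ --> X]addr0.
  apply: cvgD.
  + exact: cvg_comp cvg_fst D_cvg0.
  + exact: cvg_comp cvg_snd D_cvg0.
Unshelve. all: by end_near. Qed.
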